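(* Let $\pi:\mathbb C^{n+1}-\{0\}\to\mathbb P^n$ be the standard projection. For any subset $K\subset\mathbb P^n$, let $S(K)=\pi^{-1}(K)\cap S^{2n+1}$, where $S^{2n+1}\subset\mathbb C^{n+1}$ is the unit sphere, and let $\widehat{S(K)}_{\mathrm{poly}}$ be its polynomial hull in $\mathbb C^{n+1}$. Then the projective hull of $K$ is $$\widehat K=\pi\left\{\widehat{S(K)}_{\mathrm{poly}}-\{0\}\right\}.$$
   Context: Sections of $\mathcal O(d)$ over $\mathbb P^n$ are identified with homogeneous polynomials $P$ of degree $d$ on $\mathbb C^{n+1}$, with norm $\|\mathcal P([Z])\|=|P(Z)|/\|Z\|^d$. The projective hull $\widehat K$ of a set $K\subset\mathbb P^n$ is the set of $x\in\mathbb P^n$ for which there is a constant $C=C_x>0$ with $\|\mathcal P(x)\|\le C^d\sup_K\|\mathcal P\|$ for all $\mathcal P\in H^0(\mathbb P^n,\mathcal O(d))$ and all $d>0$. The polynomial hull of $A\subset\mathbb C^{n+1}$ is the set of $z\in\mathbb C^{n+1}$ with $|p(z)|\le\sup_A|p|$ for all polynomials $p$ on $\mathbb C^{n+1}$. *)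

(* Defs.v *)
From HB Require Import structures.
(* mpoly must be loaded before the analysis files, whose notations clash with
   its own when they come first. *)
From mathcomp Require Import all_boot all_order all_algebra generic_quotient.
From mathcomp Require Import complex mpoly.
From mathcomp Require Import boolp classical_sets reals constructive_ereal ereal.

Set Implicit Arguments.
Unset Strict Implicit.
Unset Printing Implicit Defensive.

Import Order.TTheory GRing.Theory Num.Theory.

Local Open Scope quotient_scope.
Local Open Scope classical_set_scope.
Local Open Scope ring_scope.

Definition cabs (R : realType) (z : R[i]) : R := ComplexField.Normc.normc z.

Definition hnorm (R : realType) (m : nat) (Z : 'rV[R[i]]_m) : R :=
  Num.sqrt (\sum_i cabs (Z ord0 i) ^+ 2).

Definition eval (R : realType) (m : nat) (p : {mpoly R[i][m]})
    (Z : 'rV[R[i]]_m) : R[i] :=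
  p.@[Z ord0].

Section ProjectiveSpace.
Variables (R : realType) (n : nat).

(* C^(n+1) - {0} *)
Definition punctured := {Z : 'rV[R[i]]_n.+1 | Z != 0}.

Definition proportional (Z W : punctured) : bool :=
  `[< exists2 c : R[i], c != 0 & val W = c *: val Z >].

Fact proportional_refl : reflexive proportional.
Proof. by move=> Z; apply/asboolP; exists 1; rewrite ?oner_eq0 ?scale1r. Qed.

Fact proportional_sym : ssrbool.symmetric proportional.
Proof.
suff sub Z W : proportional Z W -> proportional W Z.
  by move=> Z W; apply/idP/idP; apply: sub.
move=> /asboolP[c c0 e]; apply/asboolP; exists c^-1; first by rewrite invr_eq0.
by rewrite e scalerA mulVf ?scale1r.
Qed.

Fact proportional_trans : transitive proportional.
Proof.
move=> W Z V /asboolP[c c0 ec] /asboolP[d d0 ed]; apply/asboolP.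
by exists (d * c); rewrite ?mulf_neq0 // ed ec scalerA.
Qed.

Canonical proportional_equiv :=
  EquivRel proportional proportional_refl proportional_sym proportional_trans.

Definition projective_space := {eq_quot proportional_equiv}.

Definition proj (Z : punctured) : projective_space :=
  \pi_projective_space Z.

Lemma projP (Z W : punctured) :
  proj Z = proj W <-> exists2 c : R[i], c != 0 & val W = c *: val Z.
Proof.
split=> [/eqP|h]; first by rewrite /proj eqmodE => /asboolP.
by apply/eqP; rewrite /proj eqmodE; apply/asboolP.
Qed.

Lemma proj_surj (x : projective_space) : exists Z, proj Z = x.
Proof. by exists (repr x); rewrite /proj reprK. Qed.

(* The library type [dhomog n.+1 R[i] d] of homogeneous polynomials of degree d
   (including 0) is H^0(P^n, O(d)).  The value below does not depend on the
   representative of x: see [section_norm_proj]. *)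
Definition section_norm (d : nat) (P : dhomog n.+1 R[i] d)
    (x : projective_space) : R :=
  let Z := val (repr x) in cabs (eval P Z) / hnorm Z ^+ d.

(* Suprema are taken in the extended reals, so that they are meaningful for
   unbounded sets; the supremum of the empty set is -oo. *)
Definition projective_hull (K : set projective_space) : set projective_space :=
  [set x | exists2 C : R, 0 < C &
    forall (d : nat) (P : dhomog n.+1 R[i] d), (0 < d)%N ->
      ((section_norm P x)%:E <=
         (C ^+ d)%:E * ereal_sup [set (section_norm P y)%:E | y in K])%E].

Definition unit_sphere : set 'rV[R[i]]_n.+1 := [set Z | hnorm Z = 1].

Definition sphere_lift (K : set projective_space) : set 'rV[R[i]]_n.+1 :=
  (val @` (proj @^-1` K)) `&` unit_sphere.

End ProjectiveSpace.

Definition polynomial_hull (R : realType) (m : nat) (A : set 'rV[R[i]]_m) :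
    set 'rV[R[i]]_m :=
  [set z | forall p : {mpoly R[i][m]},
     ((cabs (eval p z))%:E <= ereal_sup [set (cabs (eval p a))%:E | a in A])%E].

Lemma cabsM (R : realType) (z w : R[i]) : cabs (z * w) = cabs z * cabs w.
Proof. exact: ComplexField.Normc.normcM. Qed.

Lemma cabs_ge0 (R : realType) (z : R[i]) : 0 <= cabs z.
Proof. by case: z => a b; apply: sqrtr_ge0. Qed.

Lemma cabs_eq0 (R : realType) (z : R[i]) : (cabs z == 0) = (z == 0).
Proof.
apply/eqP/eqP => [/ComplexField.Normc.eq0_normc //|->].
exact: ComplexField.Normc.normc0.
Qed.

Lemma cabsX (R : realType) (z : R[i]) k : cabs (z ^+ k) = cabs z ^+ k.
Proof.
elim: k => [|k IH]; first by rewrite !expr0; apply: ComplexField.Normc.normc1.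
by rewrite !exprS cabsM IH.
Qed.

Lemma hnormZ (R : realType) m (c : R[i]) (Z : 'rV[R[i]]_m) :
  hnorm (c *: Z) = cabs c * hnorm Z.
Proof.
rewrite /hnorm; under eq_bigr do rewrite mxE cabsM exprMn.
by rewrite -mulr_sumr sqrtrM ?sqr_ge0 // sqrtr_sqr ger0_norm ?cabs_ge0.
Qed.

Lemma eval_homogZ (R : realType) m d (P : dhomog m R[i] d) (c : R[i])
    (Z : 'rV[R[i]]_m) :
  eval P (c *: Z) = c ^+ d * eval P Z.
Proof.
rewrite /eval !mevalE mulr_sumr big_seq [RHS]big_seq.
apply: eq_bigr => M MP; rewrite mulrCA; congr (_ * _).
have <- : mdeg M = d by apply: (dhomog_mf (dhomog_is_dhomog P)).
under eq_bigr do rewrite mxE exprMn.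
by rewrite big_split /= prodrXr -mdegE.
Qed.

Lemma section_norm_proj (R : realType) n d (P : dhomog n.+1 R[i] d)
    (Z : punctured R n) :
  section_norm P (proj Z) = cabs (eval P (val Z)) / hnorm (val Z) ^+ d.
Proof.
have : proj (repr (proj Z)) = proj Z by rewrite /proj reprK.
rewrite /section_norm; move: (repr _) => W /projP[c c0 ->].
rewrite eval_homogZ hnormZ cabsM cabsX exprMn -mulf_div divff ?mul1r //.
by rewrite expf_neq0 // cabs_eq0.
Qed.

(* Main.v *)
Require Import Defs.
From mathcomp Require Import all_boot all_order all_algebra.
From mathcomp Require Import cyclic separable cyclotomic.
From mathcomp Require Import ring zify.
From mathcomp Require Import complex mpoly.
From mathcomp Require Import boolp classical_sets reals constructive_ereal ereal.

Set Implicit Arguments.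
Unset Strict Implicit.
Unset Printing Implicit Defensive.

Import Order.TTheory GRing.Theory Num.Theory.
Import Defs.

(** Write S for the lift of [K] to the unit sphere. For a form P the norms
    ||P(y)||, y in [K], are the numbers |P(a)|, a in S
    ([section_norm_sphere_lift]), so both hulls compare values of polynomials at
    one point with suprema over the same set S; the projective hull tests forms
    only and allows a factor C^d.

    If a nonzero Z is in the polynomial hull of S, homogeneity turns
    |P(Z)| <= sup_S |P| into the defining inequality of the projective hull with
    the constant C = 1 / |Z|.

    Conversely, let x be in the projective hull with constant C. On the line x
    take Z of norm 1 / (2C): then |P(Z)| <= 2^-d sup_S |P| for every form P of
    degree d > 0. The set S is invariant under multiplication by complex numbers
    of modulus 1, hence Cauchy's estimate bounds the homogeneous components p_d
    of any polynomial p by |p_d| <= sup_S |p| on S ([circled_cauchy]). The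
    geometric series gives |p(Z)| <= 2 sup_S |p|. Applied to the powers of p this
    reads |p(Z)|^k <= 2 (sup_S |p|)^k for all k, and the factor 2 disappears
    ([le_of_exprn_le]), so Z is in the polynomial hull ([circled_hull]).

    In Cauchy's estimate the integral over the circle is replaced by the mean
    over the N-th roots of unity for N > deg p, which extracts p_d exactly
    ([eval_hcomp_average]). *)

Local Open Scope classical_set_scope.
Local Open Scope ring_scope.

(** * Inequalities between real powers *)

Lemma bernoulli_ineq (R : realDomainType) (t : R) k :
  0 <= t -> 1 + k%:R * t <= (1 + t) ^+ k.
Proof.
move=> t0; elim: k => [|k IH]; first by rewrite mul0r addr0 expr0.
have t1 : 0 <= 1 + t by rewrite addr_ge0.
rewrite exprSr; apply: le_trans (ler_wpM2r t1 IH); rewrite -subr_ge0 -natr1.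
have -> : (1 + k%:R * t) * (1 + t) - (1 + (k%:R + 1) * t) = k%:R * t ^+ 2.
  by ring.
by rewrite mulr_ge0 ?sqr_ge0.
Qed.

(** A bound on all powers, up to a factor [c] that does not depend on the
    exponent, is a bound without the factor: take [k]-th roots and let [k] grow.
    Bernoulli's inequality replaces the limit. *)
Lemma le_of_exprn_le (R : realType) (c x y : R) : 0 <= y ->
  (forall k, x ^+ k <= c * y ^+ k) -> x <= y.
Proof.
move=> y0 H; rewrite leNgt; apply/negP => yx.
have [y_eq0|yn0] := eqVneq y 0.
  by have := H 1%N; rewrite !expr1 y_eq0 mulr0 -y_eq0 leNgt yx.
have yp : 0 < y by rewrite lt0r yn0.
have c0 : 0 <= c by have := H 0%N; rewrite !expr0 mulr1; apply: le_trans.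
pose t := x / y - 1.
have t0 : 0 < t by rewrite subr_gt0 ltr_pdivlMr // mul1r.
have kt k : k%:R * t <= c.
  have := bernoulli_ineq k (ltW t0).
  have -> : 1 + t = x / y by rewrite addrC subrK.
  move=> le1; apply: (@le_trans _ _ (1 + k%:R * t)); first by rewrite lerDr.
  by apply: le_trans le1 _; rewrite expr_div_n ler_pdivrMr ?exprn_gt0.
have := archi_boundP (divr_ge0 c0 (ltW t0)).
by rewrite ltr_pdivrMr // ltNge kt.
Qed.

Lemma sum_expr_half (R : realType) N : \sum_(d < N) (2^-1 : R) ^+ d <= 2.
Proof.
suff -> : \sum_(d < N) (2^-1 : R) ^+ d = 2 - 2 * 2^-1 ^+ N.
  by rewrite gerBl mulr_ge0 // exprn_ge0 // invr_ge0.
elim: N => [|N IH]; first by rewrite big_ord0 expr0 mulr1 subrr.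
rewrite big_ord_recr /= IH exprS mulrA divff ?pnatr_eq0 // mul1r.
by ring.
Qed.

(** * Roots of unity *)

Lemma prim_root_exists (F : closedFieldType) N :
  N%:R != 0 :> F -> exists w : F, N.-primitive_root w.
Proof.
move=> Nn0; have N_gt0 : (0 < N)%N by case: N Nn0; rewrite ?eqxx.
(* 'X^N - 1 is separable, so its root list r has N distinct entries. *)
have [r Dp] := closed_field_poly_normal ('X^N - 1 : {poly F}).
rewrite (monicP _) ?monicXnsubC // scale1r in Dp.
have rN1 : all N.-unity_root r by apply/allP=> z; rewrite -root_prod_XsubC -Dp.
have sz_r : (N < (size r).+1)%N.
  by rewrite -(size_prod_XsubC r id) -Dp size_XnsubC.
have [|w _ pw] := hasP (has_prim_root N_gt0 rN1 _ sz_r); last by exists w.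
by rewrite -separable_prod_XsubC -Dp separable_Xn_sub_1.
Qed.

Lemma sum_expr_prim_root (F : fieldType) N (w : F) k :
  N.-primitive_root w ->
  \sum_(j < N) (w ^+ k) ^+ j = if (N %| k)%N then N%:R else 0.
Proof.
move=> pw; rewrite (prim_order_dvd pw); case: eqP => [->|/eqP wk].
  by under eq_bigr do rewrite expr1n; rewrite sumr_const card_ord.
apply: (@mulfI _ (w ^+ k - 1)); first by rewrite subr_eq0.
by rewrite mulr0 -subrX1 exprAC (prim_expr_order pw) expr1n subrr.
Qed.

(** * Polynomial hulls of circle-invariant sets *)

Section Polynomials.
Variables (R : realType) (m : nat).
Local Notation C := R[i].
Implicit Types (p : {mpoly C[m]}) (Z a : 'rV[C]_m) (A : set 'rV[C]_m).

Lemma cabs_sum I (r : seq I) (F : I -> C) :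
  cabs (\sum_(i <- r) F i) <= \sum_(i <- r) cabs (F i).
Proof.
elim/big_ind2: _ => [|x u y v xu yv|//].
  by rewrite /cabs ComplexField.Normc.normc0.
exact: le_trans (le_normcD _ _) (lerD xu yv).
Qed.

Lemma cabs_nat N : cabs (N%:R : C) = N%:R.
Proof. by rewrite /cabs normcMn ComplexField.Normc.normc1. Qed.

Lemma hnorm_gt0 Z : Z != 0 -> 0 < hnorm Z.
Proof.
move=> Z0; rewrite sqrtr_gt0 lt0r sumr_ge0 => [|i _]; last exact: sqr_ge0.
rewrite andbT.
apply: contra Z0; rewrite psumr_eq0 => [/allP h|i _]; last exact: sqr_ge0.
apply/eqP/rowP => i; rewrite mxE; apply/eqP.
by rewrite -cabs_eq0 -sqrf_eq0; apply: h (mem_index_enum i).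
Qed.

Lemma cabs_real (x : R) : 0 <= x -> cabs (x%:C)%C = x.
Proof. by move=> x0; rewrite /cabs /= expr0n addr0 sqrtr_sqr ger0_norm. Qed.

Definition hcomp d p : dhomog m C d := DHomog (pihomogP mdeg d p).

Lemma eval_hcomp_sum p N Z : (msize p <= N)%N ->
  eval p Z = \sum_(d < N) eval (hcomp d p) Z.
Proof.
by move=> le_pN; rewrite {1}(pihomog_partitionE le_pN) /eval raddf_sum.
Qed.

(** The discrete Fourier coefficient of [p] along the orbit of [Z] under the
    N-th roots of unity: all components have degree below [N], so distinct
    degrees give distinct characters and no other component contributes. The
    exponent [N - d] stands for [- d]. *)
Lemma eval_hcomp_average p N (w : C) Z (d : 'I_N) :
    N.-primitive_root w -> (msize p <= N)%N ->
  N%:R * eval (hcomp d p) Z =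
    \sum_(j < N) w ^+ (N - d) ^+ j * eval p (w ^+ j *: Z).
Proof.
move=> pw le_pN; under eq_bigr do rewrite (eval_hcomp_sum _ le_pN) mulr_sumr.
rewrite exchange_big.
have isolate (e : 'I_N) :
    \sum_(j < N) w ^+ (N - d) ^+ j * eval (hcomp e p) (w ^+ j *: Z) =
    (if (N %| N - d + e)%N then N%:R else 0) * eval (hcomp e p) Z.
  rewrite -(sum_expr_prim_root _ pw) mulr_suml; apply: eq_bigr => j _.
  by rewrite eval_homogZ mulrA exprD exprMn [w ^+ e ^+ j]exprAC.
under eq_bigr do rewrite isolate.
rewrite (bigD1 d) // subnK 1?ltnW // dvdnn big1 => [|e ne_ed].
  by rewrite [RHS]addr0.
case: ifP => [/dvdnP[q qE]|_]; last by rewrite mul0r.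
case/negP: ne_ed; apply/eqP/val_inj => /=.
(* 0 < N - d + e < 2 N leaves only the quotient 1 *)
move: qE (ltn_ord d) (ltn_ord e); case: q => [|[|q]]; lia.
Qed.

Definition circled A := forall c a, cabs c = 1 -> A a -> A (c *: a).

(** Cauchy's estimate: on a circle-invariant set a homogeneous component is a
    mean of values of [p], up to factors of modulus 1. *)
Lemma circled_cauchy A p (M : R) d : circled A ->
    (forall a, A a -> cabs (eval p a) <= M) ->
  forall a, A a -> cabs (eval (hcomp d p) a) <= M.
Proof.
move=> cA pM a Aa; pose N := maxn (msize p) d.+1.
have le_pN : (msize p <= N)%N by apply: leq_maxl.
have lt_dN : (d < N)%N by apply: leq_maxr.
have N0 : (0 < N)%N by apply: leq_ltn_trans lt_dN.
have [|w pw] := @prim_root_exists C N; first by rewrite pnatr_eq0 -lt0n.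
have w1 k : cabs (w ^+ k) = 1.
  have /eqP : cabs w ^+ N = 1.
    by rewrite -cabsX (prim_expr_order pw) /cabs ComplexField.Normc.normc1.
  by rewrite pexpr_eq1 ?cabs_ge0 // cabsX => /eqP ->; rewrite expr1n.
rewrite -(@ler_pM2l _ N%:R) ?ltr0n // -[X in X * _]cabs_nat -cabsM.
rewrite (eval_hcomp_average _ (Ordinal lt_dN) pw le_pN).
apply: le_trans (cabs_sum _ _) _.
apply: (@le_trans _ _ (\sum_(j < N) M)); last first.
  by rewrite sumr_const card_ord mulr_natl.
apply: ler_sum => j _; rewrite cabsM cabsX w1 expr1n mul1r.
exact/pM/cA.
Qed.

(** The hypothesis tests forms of positive degree only, and its factor 2^-d
    makes the bounds on the components summable. The resulting factor 2 is
    removed by passing to powers. Forms of degree 0 are constant, so one point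
    of [A] controls them: without it the hull of [A] would be empty. *)
Lemma circled_hull A Z : circled A -> A !=set0 ->
    (forall d (P : dhomog m C d) (M : R), (0 < d)%N ->
       (forall a, A a -> cabs (eval P a) <= M) ->
       cabs (eval P Z) <= 2^-1 ^+ d * M) ->
  polynomial_hull A Z.
Proof.
move=> cA [a0 Aa0] hZ p.
case sE : ereal_sup => [M||]; last 2 first.
- exact: leey.
- have : ((cabs (eval p a0))%:E <= -oo)%E.
    by rewrite -sE; apply: ereal_sup_ubound; exists a0.
  by rewrite leeNy_eq.
have pM a : A a -> cabs (eval p a) <= M.
  by move=> Aa; rewrite -lee_fin -sE; apply: ereal_sup_ubound; exists a.
have M0 : 0 <= M by apply: le_trans (pM _ Aa0); apply: cabs_ge0.
rewrite lee_fin; apply: (@le_of_exprn_le _ 2) => // k.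
have evalX a : eval (p ^+ k) a = eval p a ^+ k by rewrite /eval rmorphXn.
have pkM a : A a -> cabs (eval (p ^+ k) a) <= M ^+ k.
  by move=> Aa; rewrite evalX cabsX lerXn2r ?nnegrE ?cabs_ge0 ?pM.
rewrite -cabsX -evalX (eval_hcomp_sum _ (leqnn _)).
apply: le_trans (cabs_sum _ _) _.
apply: (@le_trans _ _ (\sum_(d < msize (p ^+ k)) 2^-1 ^+ d * M ^+ k)).
  apply: ler_sum => -[d _] _ /=; have := circled_cauchy d cA pkM.
  case: d => [|d] hM; last exact: (hZ _ (hcomp d.+1 (p ^+ k))).
  rewrite expr0 mul1r.
  have const b : eval (hcomp 0 (p ^+ k)) b = eval (hcomp 0 (p ^+ k)) 0.
    by rewrite -(scale0r b) eval_homogZ expr0 mul1r.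
  by rewrite const -(const a0) hM.
by rewrite -mulr_suml ler_wpM2r ?exprn_ge0 ?sum_expr_half.
Qed.

End Polynomials.

(** * The lift of a projective set to the sphere *)

Section Sphere.
Variables (R : realType) (n : nat) (K : set (projective_space R n)).

Lemma scale_proj (Z : punctured R n) (c : R[i]) : c != 0 ->
  exists2 W : punctured R n, val W = c *: val Z & proj W = proj Z.
Proof.
move=> c0; have W0 : c *: val Z != 0 by rewrite scaler_eq0 negb_or c0 (valP Z).
exists (exist _ (c *: val Z) W0) => //; apply/esym/projP; by exists c.
Qed.

(** On the line [x] there are vectors of every positive norm. The norm 1
    gives points of the sphere, the norm 1 / (2C) the point of the polynomial
    hull. *)
Lemma rescale_hnorm (x : projective_space R n) (r : R) : 0 < r ->
  exists2 Z : punctured R n, hnorm (val Z) = r & proj Z = x.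
Proof.
move=> r0; have [Z <-] := proj_surj x; have h0 := hnorm_gt0 (valP Z).
have q0 : 0 < r / hnorm (val Z) by rewrite divr_gt0.
have [|W WE pW] := @scale_proj Z ((r / hnorm (val Z))%:C)%C.
  by rewrite -cabs_eq0 cabs_real ?ltW // gt_eqF.
by exists W => //; rewrite WE hnormZ cabs_real ?ltW // divfK ?gt_eqF.
Qed.

Lemma circled_sphere_lift : circled (sphere_lift K).
Proof.
move=> c _ c1 [[Z KZ <-] Z1]; have [|W WE pW] := @scale_proj Z c.
  by rewrite -cabs_eq0 c1 oner_eq0.
split; last by rewrite /unit_sphere /= hnormZ c1 mul1r.
by exists W => //=; rewrite pW.
Qed.

Lemma sphere_lift_nonempty : K !=set0 -> sphere_lift K !=set0.
Proof.
by move=> [y Ky]; have [Z Z1 pZ] := rescale_hnorm y ltr01;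
  exists (val Z); split => //; exists Z => //=; rewrite pZ.
Qed.

Lemma section_norm_sphere_lift d (P : dhomog n.+1 R[i] d) :
  [set (section_norm P y)%:E | y in K] =
  [set (cabs (eval P a))%:E | a in sphere_lift K].
Proof.
apply/seteqP; split=> [_ [y Ky <-]|_ [_ [[Z KZ <-] Z1] <-]].
  have [Z Z1 pZ] := rescale_hnorm y ltr01.
  exists (val Z); first by split => //; exists Z => //=; rewrite pZ.
  by rewrite -pZ section_norm_proj Z1 expr1n divr1.
exists (proj Z) => //.
by rewrite section_norm_proj Z1 expr1n divr1.
Qed.

End Sphere.

Theorem theorem5p7 (R : realType) (n : nat) (K : set (projective_space R n)) :
  projective_hull K =
    @proj R n @` (val @^-1` polynomial_hull (sphere_lift K)).
Proof.
apply/seteqP; split=> x; last first.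
  move=> [Z hZ <-]; have h0 := hnorm_gt0 (valP Z).
  exists (hnorm (val Z))^-1; rewrite ?invr_gt0 // => d P _.
  rewrite section_norm_proj section_norm_sphere_lift mulrC -exprVn EFinM.
  by rewrite lee_wpmul2l ?lee_fin ?exprn_ge0 ?invr_ge0 ?(ltW h0) //; apply: hZ.
move=> [C C0 hx].
(* for empty K the hull inequality would bound 0, the norm of the zero
   section, by the supremum -oo *)
have K0 : K !=set0.
  apply/set0P/negP => /eqP K0; have := hx 1%N 0 isT.
  by rewrite K0 image_set0 ereal_sup0 expr1 gt0_muleNy // leeNy_eq.
have C2V : 0 < (2 * C)^-1 by rewrite invr_gt0 mulr_gt0.
have [Z Zn pZ] := rescale_hnorm x C2V.
exists Z => //; apply: circled_hull.
- exact: circled_sphere_lift.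
- exact: sphere_lift_nonempty.
move=> d P M d0 PM.
have supM : (ereal_sup [set (section_norm P y)%:E | y in K] <= M%:E)%E.
  rewrite section_norm_sphere_lift; apply: ge_ereal_sup => _ [a Sa <-].
  by rewrite lee_fin PM.
have : ((section_norm P x)%:E <= (C ^+ d * M)%:E)%E.
  apply: le_trans (hx d P d0) _; rewrite EFinM lee_wpmul2l //.
  by rewrite lee_fin exprn_ge0 // ltW.
rewrite lee_fin -pZ section_norm_proj Zn -exprVn invrK => le1.
have C2 : 0 < (2 * C) ^+ d by rewrite exprn_gt0 // mulr_gt0.
rewrite -(ler_pM2r C2); apply: le_trans le1 _.
by rewrite mulrAC -exprMn mulrA mulVf ?mul1r.
Qed.
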